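(* The following equalities of classes of bornological $k$-vector spaces hold: $$\mathbf{bLB}=\{(E,\mathcal{B})\in\mathbf{CBorn}\mid (E,\mathcal{B})=(E,\tau)^{\mathrm b}\text{ for some }(E,\tau)\in\mathbf{LB}\}$$ $$\phantom{\mathbf{bLB}}=\{(E,\mathcal{B})\in\mathbf{LBb}\mid (E,\mathcal{B})=(E,\tau)^{\mathrm b}\text{ for some }(E,\tau)\in\mathbf{Tc}\}.$$
   Context: Let $k\in\{\mathbb{R},\mathbb{C}\}$. A bornological $k$-vector space of convex type (bvs) is a $k$-vector space $E$ with a family $\mathcal{B}$ of subsets (''bounded sets'') that covers $E$ and is closed under subsets, finite unions, sums, scalar multiples and absolutely convex hulls; morphisms are the linear maps sending bounded sets to bounded sets. $\mathbf{Born}$ is the category of bvs. $\mathbf{Tc}$ is the category of (possibly non-Hausdorff) locally convex topological $k$-vector spaces (lcs) and continuous linear maps. The functor $(\cdot)^{\mathrm b}\colon\mathbf{Tc}\to\mathbf{Born}$ equips $(E,\tau)$ with all its $\tau$-bounded sets. (Semi-)normed spaces are regarded as lcs. $\mathbf{CBorn}\subseteq\mathbf{Born}$ is the full subcategory of separated complete bvs: those in which every bounded set is contained in a bounded Banach disk, i.e. in an absolutely convex $B\in\mathcal{B}$ such that $E_B=\operatorname{span}B$ with the Minkowski functional $\|e\|_B=\inf\{\lambda>0:e\in\lambda B\}$ is a Banach space. $\mathbf{LB}\subseteq\mathbf{Tc}$ consists of the LB-spaces, i.e. the lcs $(E,\tau)\cong\operatorname{colim}_{n\in\mathbb{N}}(E_n,\|\cdot\|_n)$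 (colimit in $\mathbf{Tc}$) for some sequence of Banach spaces $(E_1,\|\cdot\|_1)\to(E_2,\|\cdot\|_2)\to\cdots$ with injective continuous linear linking maps (a defining sequence). An LB-space is regular if $(E,\tau)^{\mathrm b}\cong\operatorname{colim}_n(E_n,\|\cdot\|_n)^{\mathrm b}$ in $\mathbf{Born}$ for some (equivalently, every) defining sequence; that is, every bounded subset of $(E,\tau)$ is contained and bounded in some $(E_n,\|\cdot\|_n)$. $\mathbf{bLB}$ is the full subcategory of $\mathbf{Born}$ of all $(E,\mathcal{B})\cong(E,\tau)^{\mathrm b}$ with $(E,\tau)$ a regular LB-space. $\mathbf{LBb}$ is the full subcategory of $\mathbf{Born}$ of all $(E,\mathcal{B})\cong\operatorname{colim}_{n\in\mathbb{N}}(E_n,\|\cdot\|_n)^{\mathrm b}$ (colimit in $\mathbf{Born}$) for a sequence of Banach spaces with injective continuous linear linking maps. In such a colimit in $\mathbf{Born}$, the underlying space is the union of the $E_n$ and a set is bounded iff it is contained and bounded in some $E_n$. *)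

(* Defs.v *)
From HB Require Import structures.
From mathcomp Require Import all_boot all_order all_algebra.
From mathcomp Require Import interval_inference.
From mathcomp Require Import boolp classical_sets functions.
From mathcomp Require Import reals topology normedtype convex.

Set Implicit Arguments.
Unset Strict Implicit.
Unset Printing Implicit Defensive.

Import Order.TTheory GRing.Theory Num.Theory.
Import numFieldNormedType.Exports.

Local Open Scope classical_set_scope.
Local Open Scope ring_scope.

(* Everything is set up over an arbitrary numFieldType K; the theorem takes K
   to be R or R[i]. When K = R[i], the norms are K-valued and 0 < l (or l <= m)
   entails that l (or m - l) is real. *)

Section AbsolutelyConvex.
Variables (K : numFieldType) (E : lmodType K).
Implicit Types A B : set E.

Definition dilate (c : K) A : set E := [set c *: x | x in A].

Definition minkowski_sum A B : set E := [set x + y | x in A & y in B].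

Definition absolutely_convex A : Prop :=
  forall (a b : K) (x y : E),
    A x -> A y -> `|a| + `|b| <= 1 -> A (a *: x + b *: y).

Definition absconvex_hull A : set E :=
  \bigcap_(C in [set C | absolutely_convex C /\ A `<=` C]) C.

Definition linear_span A : set E :=
  [set x | exists (n : nat) (c : 'I_n -> K) (e : 'I_n -> E),
    (forall i, A (e i)) /\ x = \sum_(i < n) c i *: e i].

(* The infimum is the greatest lower bound in the partial order of K. *)
Definition minkowski_functional B (e : E) : K :=
  infimum 0 [set l : K | 0 < l /\ dilate l B e].

(* [V] together with [f] is the normed space E_B = (span B, ||.||_B). *)
Definition banach_disk B : Prop :=
  absolutely_convex B /\
  exists (V : completeNormedModType K) (f : {linear V -> E}),
    [/\ injective f, range f = linear_span B &
        forall v, `|v| = minkowski_functional B (f v)].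

End AbsolutelyConvex.

Record convex_bornology (K : numFieldType) (E : lmodType K)
    (bnd : set (set E)) : Prop := ConvexBornology {
  bnd_cover : forall x, exists2 B, bnd B & B x ;
  bnd_subset : forall A B, A `<=` B -> bnd B -> bnd A ;
  bnd_union : forall A B, bnd A -> bnd B -> bnd (A `|` B) ;
  bnd_sum : forall A B, bnd A -> bnd B -> bnd (minkowski_sum A B) ;
  bnd_scale : forall (c : K) A, bnd A -> bnd (dilate c A) ;
  bnd_hull : forall A, bnd A -> bnd (absconvex_hull A)
}.

Record bvsType (K : numFieldType) := BvsType {
  bvs_space :> lmodType K ;
  bounded : set (set bvs_space) ;
  bvs_axioms : convex_bornology bounded
}.
Arguments BvsType {K} bvs_space bounded bvs_axioms.
Arguments bounded {K} b _.

Definition bounded_map (K : numFieldType) (E F : bvsType K)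
    (f : {linear E -> F}) : Prop :=
  forall A, bounded E A -> bounded F (f @` A).

Definition bvs_isomorphic (K : numFieldType) (E F : bvsType K) : Prop :=
  exists (f : {linear E -> F}) (g : {linear F -> E}),
    [/\ cancel f g, cancel g f, bounded_map f & bounded_map g].

Section VonNeumannBornology.
Variables (K : numFieldType) (T : tvsType K).
Implicit Types A B U : set T.

Definition tvs_bounded A : Prop :=
  forall U, nbhs (0 : T) U -> exists2 r : K, 0 < r & A `<=` dilate r U.

Let convex_comb (C : set T) (x y : T) (t : K) : convex_set C ->
  C x -> C y -> 0 <= t -> t <= 1 -> C (t *: x + (1 - t) *: y).
Proof.
move=> cC Cx Cy t0 t1.
have := cC x y (Itv01 t0 t1) (mem_set Cx) (mem_set Cy).
by rewrite inE.
Qed.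

Lemma absconvex_nbhs0 U : nbhs (0 : T) U ->
  exists V : set T, [/\ nbhs (0 : T) V, absolutely_convex V & V `<=` U].
Proof.
move=> U0; have [Bs Bsc [Bso Bsn]] := @locally_convex K T.
have [C [BC C0] CU] := Bsn 0 U U0.
have cC : convex_set C by apply: Bsc; rewrite inE.
have nC : nbhs (0 : T) C by apply: open_nbhs_nbhs; split => //; exact: Bso.
have := @scale_continuous K T (0, 0) C; rewrite /= scaler0 => /(_ nC).
move=> [/= [D W] [/= D0 W0] DW].
have [e e0 De] : exists2 e : K, 0 < e & forall a : K, `|a| <= e -> D a.
  move: D0; rewrite -nbhs_ballE => -[e /= e0 eD]; exists (e / 2).
    by rewrite divr_gt0.
  move=> a ae; apply: eD; rewrite -ball_normE /= sub0r normrN.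
  by rewrite (le_lt_trans ae)// ltr_pdivrMr// mulr_natr mulr2n ltrDl.
pose V : set T := [set x | forall a : K, `|a| <= 1 -> C (a *: x)].
exists V; split.
- have := @nbhs0Z K T W e (lt0r_neq0 e0) W0; apply: filterS => _ [w Ww <-] a a1.
  rewrite scalerA; apply: (DW (a * e, w)); split => //=; apply: De.
  by rewrite normrM (gtr0_norm e0) ler_piMl// ltW.
- have half (a c : K) (x : T) : V x -> a != 0 -> `|c * a| <= 1 ->
      exists2 X, C X & c *: (a *: x) = `|c * a| *: X.
    move=> Vx a0 ca1; have [ca|ca] := eqVneq (c * a) 0.
      by exists 0 => //; rewrite scalerA ca normr0 !scale0r.
    exists (((c * a) / `|c * a|) *: x).
      by apply: Vx; rewrite normrM normfV normr_id divff// normr_eq0.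
    rewrite !scalerA; congr (_ *: _).
    by rewrite mulrCA divff ?mulr1// normr_eq0.
  move=> a b x y Vx Vy ab1 c c1; rewrite scalerDr.
  have [->|a0] := eqVneq a 0.
    rewrite scale0r scaler0 add0r scalerA; apply: Vy.
    rewrite normrM mulr_ile1//; apply: le_trans ab1.
    by rewrite lerDr.
  have [->|b0] := eqVneq b 0.
    rewrite scale0r scaler0 addr0 scalerA; apply: Vx.
    rewrite normrM mulr_ile1//; apply: le_trans ab1.
    by rewrite lerDl.
  have cab : `|c * a| + `|c * b| <= 1.
    rewrite !normrM -mulrDr mulr_ile1//; exact: addr_ge0.
  have ca1 : `|c * a| <= 1 by apply: le_trans cab; rewrite lerDl.
  have cb1 : `|c * b| <= 1 by apply: le_trans cab; rewrite lerDr.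
  have [X CX ->] := half a c x Vx a0 ca1.
  have [Y CY ->] := half b c y Vy b0 cb1.
  have [->|c0] := eqVneq c 0.
    by rewrite !mul0r normr0 !scale0r addr0.
  have p0 : 0 < `|c * a| by rewrite normr_gt0 mulf_neq0.
  have q0 : 0 < `|c * b| by rewrite normr_gt0 mulf_neq0.
  set p := `|c * a| in cab p0 *; set q := `|c * b| in cab q0 *.
  have pq0 : 0 < p + q by rewrite addr_gt0.
  have Z : C ((p / (p + q)) *: X + (1 - p / (p + q)) *: Y).
    apply: convex_comb => //; first by rewrite divr_ge0// ltW.
    by rewrite ler_pdivrMr// mul1r lerDl ltW.
  have := convex_comb cC Z C0 (ltW pq0) cab.
  rewrite scaler0 addr0 scalerDr !scalerA.
  rewrite [(p + q) * (1 - _)]mulrBr mulr1 ![(p + q) * _]mulrC divfK ?gt_eqF//.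
  by rewrite addrAC subrr add0r.
- move=> x Vx; apply: CU.
  by have := Vx 1; rewrite normr1 scale1r; exact.
Qed.

Lemma tvs_boundedP A : (forall U, nbhs (0 : T) U -> absolutely_convex U ->
  exists2 r : K, 0 < r & A `<=` dilate r U) -> tvs_bounded A.
Proof.
move=> bA U /absconvex_nbhs0[V [nV cV VU]]; have [r r0 Ar] := bA V nV cV.
by exists r => // x /Ar[y Vy <-]; exists y => //; exact: VU.
Qed.

Let dilateS (U : set T) (r s : K) : absolutely_convex U -> 0 < s ->
  `|r| <= s -> dilate r U `<=` dilate s U.
Proof.
move=> cU s0 rs _ [x Ux <-]; exists ((r / s) *: x); last first.
  by rewrite scalerA mulrCA divff ?mulr1// gt_eqF.
have -> : (r / s) *: x = (r / s) *: x + 0 *: x by rewrite scale0r addr0.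
apply: cU => //.
by rewrite normr0 addr0 normrM normfV (gtr0_norm s0) ler_pdivrMr// mul1r.
Qed.

Let dilateD (U : set T) (r s : K) (x y : T) : absolutely_convex U ->
  0 < r -> 0 < s -> dilate r U x -> dilate s U y -> dilate (r + s) U (x + y).
Proof.
move=> cU r0 s0 [u Uu <-] [v Uv <-]; have rs0 : 0 < r + s by rewrite addr_gt0.
exists ((r / (r + s)) *: u + (s / (r + s)) *: v).
  apply: cU => //; rewrite !normrM normfV !gtr0_norm//.
  by rewrite -mulrDl divff// gt_eqF.
by rewrite scalerDr !scalerA ![(r + s) * _]mulrC !divfK// gt_eqF.
Qed.

Lemma tvs_bounded_bornology : convex_bornology tvs_bounded.
Proof.
split.
- move=> x; exists [set x] => // U U0.
  have := @scale_continuous K T (0, x) U; rewrite /= scale0r => /(_ U0).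
  move=> [/= [D W] [/= D0 W0] DW].
  move: D0; rewrite -nbhs_ballE => -[e /= e0 eD].
  have e20 : 0 < e / 2 by rewrite divr_gt0.
  exists (e / 2)^-1; first by rewrite invr_gt0.
  move=> _ ->; exists ((e / 2) *: x).
    apply: (DW (e / 2, x)); split => /=; last exact: nbhs_singleton.
    apply: eD; rewrite -ball_normE /= sub0r normrN (gtr0_norm e20).
    by rewrite ltr_pdivrMr// mulr_natr mulr2n ltrDl.
  by rewrite scalerA mulVf ?scale1r// gt_eqF.
- by move=> A B AB bB U /bB[r r0 Br]; exists r => //; exact: subset_trans Br.
- move=> A B bA bB; apply: tvs_boundedP => U U0 cU.
  have [r r0 Ar] := bA U U0; have [s s0 Bs] := bB U U0.
  have rs0 : 0 < r + s by rewrite addr_gt0.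
  exists (r + s) => // x [/Ar|/Bs]; apply: dilateS => //;
    by rewrite gtr0_norm// ?lerDl ?lerDr ltW.
- move=> A B bA bB; apply: tvs_boundedP => U U0 cU.
  have [r r0 Ar] := bA U U0; have [s s0 Bs] := bB U U0.
  exists (r + s); first by rewrite addr_gt0.
  by move=> _ [x /Ar Ux] [y /Bs Uy] <-; exact: dilateD.
- move=> c A bA; apply: tvs_boundedP => U U0 cU.
  have [r r0 Ar] := bA U U0.
  have cr0 : 0 < `|c| * r + r by rewrite ltr_wpDl// mulr_ge0// ltW.
  exists (`|c| * r + r) => // _ [x /Ar[u Uu <-] <-].
  apply: (dilateS (r := c * r) cU cr0).
    by rewrite normrM (gtr0_norm r0) lerDl ltW.
  by exists u => //; rewrite scalerA.
- move=> A bA; apply: tvs_boundedP => U U0 cU.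
  have [r r0 Ar] := bA U U0; exists r => // x; apply; split => //.
  move=> a b _ _ [u Uu <-] [v Uv <-] ab; exists (a *: u + b *: v).
    exact: cU.
  by rewrite scalerDr !scalerA ![r * _]mulrC.
Qed.

(* The functor (-)^b : Tc -> Born on objects. *)
Definition tvs_born : bvsType K := BvsType T tvs_bounded tvs_bounded_bornology.

End VonNeumannBornology.

Definition complete_bvs (K : numFieldType) (E : bvsType K) : Prop :=
  forall A, bounded E A ->
    exists B : set E, [/\ bounded E B, banach_disk B & A `<=` B].

Record banach_seq (K : numFieldType) := BanachSeq {
  step :> nat -> completeNormedModType K ;
  link : forall n, {linear step n -> step n.+1} ;
  link_injective : forall n, injective (link n) ;
  link_continuous : forall n, continuous (link n)
}.

Arguments link {K} b n.

Section Colimits.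
Variables (K : numFieldType) (S : banach_seq K).

Definition cocone (F : lmodType K) (j : forall n, {linear S n -> F}) : Prop :=
  forall n x, j n.+1 (link S n x) = j n x.

Definition tc_cocone (T : tvsType K) (j : forall n, {linear S n -> T}) : Prop :=
  cocone j /\ forall n, continuous (j n).

Definition is_colim_tc (T : tvsType K) (j : forall n, {linear S n -> T}) :
    Prop :=
  tc_cocone j /\
  forall (T' : tvsType K) (j' : forall n, {linear S n -> T'}), tc_cocone j' ->
    exists h : {linear T -> T'},
      [/\ continuous h, forall n x, h (j n x) = j' n x &
          forall h' : {linear T -> T'}, continuous h' ->
            (forall n x, h' (j n x) = j' n x) -> h' =1 h].

Definition born_cocone (F : bvsType K)
    (j : forall n, {linear tvs_born (S n) -> F}) : Prop :=
  cocone j /\ forall n, bounded_map (j n).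

Definition is_colim_born (F : bvsType K)
    (j : forall n, {linear tvs_born (S n) -> F}) : Prop :=
  born_cocone j /\
  forall (F' : bvsType K) (j' : forall n, {linear tvs_born (S n) -> F'}),
    born_cocone j' ->
    exists h : {linear F -> F'},
      [/\ bounded_map h, forall n x, h (j n x) = j' n x &
          forall h' : {linear F -> F'}, bounded_map h' ->
            (forall n x, h' (j n x) = j' n x) -> h' =1 h].

End Colimits.

Section Classes.
Variable K : numFieldType.

Definition LB_space (T : tvsType K) : Prop :=
  exists (S : banach_seq K) (j : forall n, {linear S n -> T}), is_colim_tc j.

(* The colimit cocone of T in Tc is also a colimit cocone of (T)^b in Born,
   i.e. the canonical map colim (E_n)^b -> (colim E_n)^b is an isomorphism. *)
Definition regular_LB_space (T : tvsType K) : Prop :=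
  exists (S : banach_seq K) (j : forall n, {linear S n -> T}),
    is_colim_tc j /\ @is_colim_born K S (tvs_born T) j.

(* Classes of bvs are predicates: [bvsType K] is too large for [set]. *)
Definition CBorn (E : bvsType K) : Prop := complete_bvs E.

Definition bLB (E : bvsType K) : Prop :=
  exists2 T : tvsType K, regular_LB_space T & bvs_isomorphic E (tvs_born T).

Definition LBb (E : bvsType K) : Prop :=
  exists (S : banach_seq K) (F : bvsType K)
    (j : forall n, {linear tvs_born (S n) -> F}),
    is_colim_born j /\ bvs_isomorphic E F.

End Classes.

(* Main.v *)
Require Import Defs.
From HB Require Import structures.
From mathcomp Require Import all_boot all_order all_algebra.
From mathcomp Require Import interval_inference.
From mathcomp Require Import boolp classical_sets reals topology normedtype.
From mathcomp Require Import convex complex ring_quotient generic_quotient.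

(** The three classes are compared along the cycle
    bLB -> LBb and Tc^b -> CBorn and LB^b -> bLB.

    Colimits are only given by universal properties, so the first task is to
    know what they are.  Write j_n : S_n -> F for a colimit cocone, in Tc or in
    Born.  Testing the universal property against F modulo the union of the
    images, with the quotient topology or the coarse bornology, shows that the
    j_n are jointly surjective; testing it against the product of the S_n modulo
    the sequences that vanish eventually shows that they are injective
    ([tc_colim_union], [born_colim_union]).  Hence F is the increasing union of
    the S_n, and in Born its bounded sets are the subsets of the images of the
    balls ([born_colim_bounded]).

    All topologies needed are instances of one construction: the finest
    locally convex topology on a vector space E that makes given linear maps
    X_i -> E continuous ([final_tvs]).  It transports a topology along an
    isomorphism, which settles bLB -> LBb and Tc^b.

    If E = T^b carries the colimit bornology of the S_n, its bounded sets lie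
    in the Banach disks j_n(ball), so E is complete.  The final topology of the
    j_n on E is an LB-topology; it is finer than that of T, because the j_n are
    bounded, hence continuous, into T; and every set bounded in E is bounded
    for it, being inside the image of a ball.  So it has the same bounded sets
    as T ([LBb_CBorn_LB]).

    If T is an LB-space and T^b is complete, then T is separated, since a line
    inside every neighbourhood of 0 would be a bounded set lying in no Banach
    disk.  Regularity is Grothendieck's factorization theorem ([LB_regular]):
    a bounded set lies in a Banach disk B; the Banach space E_B maps
    continuously to T and is covered by the preimages of the j_n(ball of radius
    m); one of these is dense in some ball by Baire's theorem ([nonmeager]);
    and successive approximation removes the closure ([approximate_lift]), so
    that a multiple of j_n(ball) contains B.

    Scalars enter only through the Archimedean property of the norm, shared by
    the real and the complex numbers. *)

Set Implicit Arguments.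
Unset Strict Implicit.
Unset Printing Implicit Defensive.

Import Order.TTheory GRing.Theory Num.Theory.
Import numFieldNormedType.Exports.

Local Open Scope classical_set_scope.
Local Open Scope ring_scope.

(** * Absolutely convex and absorbing sets *)

Section AbsConvex.
Variables (K : numFieldType) (E : lmodType K).
Implicit Types V W : set E.

Definition absorbing V := forall x, exists2 r : K, 0 < r & V (r *: x).

Lemma absconvexZ V (a : K) x : absolutely_convex V -> `|a| <= 1 -> V x ->
  V (a *: x).
Proof.
move=> cV a1 Vx; have := cV a 0 x x Vx Vx.
by rewrite normr0 addr0 scale0r addr0; apply.
Qed.

Lemma absorbing0 V : absorbing V -> V 0.
Proof. by move=> /(_ 0)[r _]; rewrite scaler0. Qed.

Lemma absconvex_half V x y : absolutely_convex V ->
  dilate 2^-1 V x -> dilate 2^-1 V y -> V (x + y).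
Proof.
move=> cV [u Vu <-] [v Vv <-]; apply: cV => //.
by rewrite gtr0_norm ?invr_gt0// -mulr2n -[_ *+ 2]mulr_natr mulVf// pnatr_eq0.
Qed.

Lemma absconvex_dilate V (c : K) : absolutely_convex V ->
  absolutely_convex (dilate c V).
Proof.
move=> cV a b _ _ [x Vx <-] [y Vy <-] ab.
exists (a *: x + b *: y); first exact: cV.
by rewrite scalerDr !scalerA ![c * _]mulrC.
Qed.

Lemma absorbing_dilate V (c : K) : 0 < c -> absorbing V ->
  absorbing (dilate c V).
Proof.
move=> c0 aV x; have [r r0 Vr] := aV x; exists (c * r); first exact: mulr_gt0.
by exists (r *: x) => //; rewrite scalerA.
Qed.

Lemma absconvexI V W : absolutely_convex V -> absolutely_convex W ->
  absolutely_convex (V `&` W).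
Proof.
by move=> cV cW a b x y [Vx Wx] [Vy Wy] ab; split; [exact: cV|exact: cW].
Qed.

(** The quotient r s / (r + s) stands in for the minimum of the two radii:
    it is a rational expression, so it exists although the order of the scalars
    is partial. *)
Lemma absorbingI V W : absolutely_convex V -> absolutely_convex W ->
  absorbing V -> absorbing W -> absorbing (V `&` W).
Proof.
move=> cV cW aV aW x; have [r r0 Vr] := aV x; have [s s0 Ws] := aW x.
have rs0 : 0 < r + s by rewrite addr_gt0.
exists (r * s / (r + s)); first by rewrite divr_gt0// mulr_gt0.
split.
  have -> : (r * s / (r + s)) *: x = (s / (r + s)) *: (r *: x).
    by rewrite scalerA mulrAC [in RHS]mulrC mulrA mulrAC.
  apply: absconvexZ => //; rewrite gtr0_norm ?divr_gt0//.
  by rewrite ler_pdivrMr// mul1r lerDr ltW.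
have -> : (r * s / (r + s)) *: x = (r / (r + s)) *: (s *: x).
  by rewrite scalerA mulrAC.
apply: absconvexZ => //; rewrite gtr0_norm ?divr_gt0//.
by rewrite ler_pdivrMr// mul1r lerDl ltW.
Qed.

End AbsConvex.

(** * Final locally convex topologies *)

Section Final.
Variables (K : numFieldType) (I : Type) (X : I -> tvsType K) (E : lmodType K).
Variable j : forall i, {linear X i -> E}.

(** The absolutely convex neighbourhoods of 0 of the finest locally convex
    topology on E for which the [j i] are continuous.  Requiring them to be
    absorbing makes the topology a vector topology even when the images of the
    [j i] do not span E. *)
Definition final_disk (V : set E) := [/\ absolutely_convex V, absorbing V &
  forall i, nbhs (0 : X i) (j i @^-1` V)].

Lemma final_diskI V W : final_disk V -> final_disk W -> final_disk (V `&` W).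
Proof.
move=> [cV aV nV] [cW aW nW]; split; first exact: absconvexI.
  exact: absorbingI.
by move=> i; rewrite preimage_setI; apply: filterI.
Qed.

Lemma final_diskZ (c : K) V : 0 < c -> final_disk V -> final_disk (dilate c V).
Proof.
move=> c0 [cV aV nV]; split; first exact: absconvex_dilate.
  exact: absorbing_dilate.
move=> i; have := nbhs0Z (lt0r_neq0 c0) (nV i); apply: filterS => _ [x Vx <-].
by exists (j i x) => //; rewrite linearZ.
Qed.

Lemma final_diskT : final_disk setT.
Proof.
split => //; first by move=> x; exists 1.
by move=> i; rewrite preimage_setT; exact: filterT.
Qed.

(** A copy of E, so that the topology depends on the family [j] and does not
    clash with another topology that E may carry. *)
Definition final_space : Type := E.

HB.instance Definition _ := GRing.Lmodule.on final_space.

Definition final_nbhs (p : final_space) : set_system final_space :=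
  [set A | exists2 V, final_disk V & forall v, V v -> A (p + v)].

HB.instance Definition _ := hasNbhs.Build final_space final_nbhs.

Lemma final_nbhs_filter (p : final_space) : ProperFilter (nbhs p).
Proof.
apply: Build_ProperFilter_ex.
  by move=> A [V [_ /absorbing0 V0 _]] /(_ 0 V0); exists (p + 0).
split.
- by exists setT => //; exact: final_diskT.
- move=> A B [V fV VA] [W fW WB]; exists (V `&` W); first exact: final_diskI.
  by move=> v [Vv Wv]; split; [exact: VA|exact: WB].
- by move=> A B AB [V fV VA]; exists V => // v /VA /AB.
Qed.

Lemma final_nbhs_singleton (p : final_space) A : nbhs p A -> A p.
Proof. by move=> [V [_ /absorbing0 V0 _] /(_ 0 V0)]; rewrite addr0. Qed.

Lemma final_nbhs_nbhs (p : final_space) A : nbhs p A -> nbhs p (nbhs^~ A).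
Proof.
move=> [V fV VA]; have fV2 : final_disk (dilate 2^-1 V).
  by apply: final_diskZ => //; rewrite invr_gt0.
exists (dilate 2^-1 V) => // v vV2; exists (dilate 2^-1 V) => // w wV2.
rewrite -addrA; apply: VA; apply: absconvex_half => //.
by case: fV.
Qed.

HB.instance Definition _ := Nbhs_isNbhsTopological.Build final_space
  final_nbhs_filter final_nbhs_singleton final_nbhs_nbhs.

Lemma final_add_continuous :
  continuous (fun x : final_space * final_space => x.1 + x.2).
Proof.
move=> [x y] A [V fV VA] /=.
have fV2 : final_disk (dilate 2^-1 V).
  by apply: final_diskZ => //; rewrite invr_gt0.
exists ([set x + v | v in dilate 2^-1 V], [set y + v | v in dilate 2^-1 V]).
  by split; exists (dilate 2^-1 V) => // v V2v; exists v.
move=> [_ _] [/= [v V2v <-] [w V2w <-]]; rewrite addrACA; apply: VA.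
by apply: absconvex_half => //; case: fV.
Qed.

Lemma final_scale_continuous :
  continuous (fun z : K^o * final_space => z.1 *: z.2).
Proof.
move=> [c x] A [V fV VA] /=.
have [cV aV nV] := fV.
have fV2 : final_disk (dilate 2^-1 V).
  by apply: final_diskZ => //; rewrite invr_gt0.
have [cV2 aV2 nV2] := fV2.
have [r r0 Vr] := aV2 x.
have M0 : 0 < `|c| + r by rewrite ltr_wpDl.
(* d (x + w) - c x is the sum of (d - c) x and d w; the first term lies in V/2
   because r x does, the second because |d| <= |c| + r. *)
exists (ball c r, [set x + v | v in dilate (`|c| + r)^-1 (dilate 2^-1 V)]).
  split; first exact: nbhsx_ballx.
  exists (dilate (`|c| + r)^-1 (dilate 2^-1 V)); last by move=> v; exists v.
  by apply: final_diskZ => //; rewrite invr_gt0.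
move=> [d _] [/= cd [_ [w Vw <-] <-]].
rewrite -ball_normE /= distrC in cd.
have -> : d *: (x + (`|c| + r)^-1 *: w) =
    c *: x + ((d - c) *: x + (d / (`|c| + r)) *: w).
  by rewrite scalerDr scalerA addrA -scalerDl [c + _]addrC subrK.
apply: VA.
apply: absconvex_half => //.
  have -> : (d - c) *: x = ((d - c) / r) *: (r *: x).
    by rewrite scalerA divfK// gt_eqF.
  apply: absconvexZ => //.
  by rewrite normrM normfV (gtr0_norm r0) ler_pdivrMr// mul1r ltW.
apply: absconvexZ => //; rewrite normrM normfV (gtr0_norm M0).
rewrite ler_pdivrMr// mul1r -{1}[d](subrK c) addrC.
by rewrite (le_trans (ler_normD _ _))// lerD2l ltW.
Qed.

Lemma final_locally_convex : exists2 B : set_system final_space,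
  (forall b, b \in B -> convex_set b) & basis B.
Proof.
exists [set U | open U /\ convex_set U]; first by move=> b; rewrite inE => -[].
split; first by move=> U [].
move=> x A [V fV VA]; pose U : set final_space :=
  [set p | nbhs p [set x + v | v in V]].
have nU : nbhs x U by apply: nbhs_interior; exists V => // v; exists v.
exists U.
  split; last exact: nbhs_singleton.
  split.
    by rewrite openE => p; exact: nbhs_interior.
  move=> p q l; rewrite !inE => -[W fW Wp] [W' fW' Wq].
  exists (W `&` W'); first exact: final_diskI.
  move=> w [/Wp[v Vv pv] /Wq[v' Vv' qv]].
  exists (l%:num *: v + (1 - l%:num) *: v').
    case: fV => + _ _; apply => //; rewrite !ger0_norm ?subr_ge0//.
    by rewrite addrC subrK.
  rewrite /= /conv /=.
  have -> : w = l%:num *: w + (1 - l%:num) *: w.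
    by rewrite -scalerDl addrC subrK scale1r.
  rewrite addrACA -!scalerDr -pv -qv !scalerDr addrACA; congr (_ + _).
  by rewrite -scalerDl addrC subrK scale1r.
by move=> p /nbhs_singleton[v Vv <-]; exact: VA.
Qed.

HB.instance Definition _ := PreTopologicalLmod_isTvs.Build K final_space
  final_add_continuous final_scale_continuous final_locally_convex.
HB.instance Definition _ :=
  PreTopologicalNmodule_isTopologicalNmodule.Build final_space
    final_add_continuous.
HB.instance Definition _ :=
  TopologicalNmodule_isTopologicalLmodule.Build K final_space
    final_scale_continuous.
HB.instance Definition _ :=
  Uniform_isTvs.Build K final_space final_locally_convex.

Definition final_tvs : tvsType K := final_space.

Lemma final_nbhs0E (A : set final_tvs) :
  nbhs (0 : final_tvs) A <-> exists2 V, final_disk V & V `<=` A.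
Proof.
split=> -[V fV VA]; exists V => // v /VA; first by rewrite add0r.
by rewrite add0r.
Qed.

End Final.

(** * Continuity and boundedness of linear maps *)

Section LinearContinuity.
Variable K : numFieldType.
Implicit Types T : tvsType K.

Lemma linear_continuous0 T T' (f : {linear T -> T'}) :
  (forall U, nbhs (0 : T') U -> nbhs (0 : T) (f @^-1` U)) -> continuous f.
Proof.
move=> cf x A nA.
have /cf/(nbhsT x) : nbhs (0 : T') [set u | A (f x + u)].
  have := @nbhsB K T' A (f x) (- f x) nA; rewrite addNr.
  by apply: filterS => _ [u Au <-]; rewrite /= addrA subrr add0r.
by apply: filterS => _ [v Av <-]; rewrite /= linearD.
Qed.

Lemma continuous_linear0 T T' (f : {linear T -> T'}) : continuous f ->
  forall U, nbhs (0 : T') U -> nbhs (0 : T) (f @^-1` U).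
Proof. by move=> cf U; have := cf 0 U; rewrite linear0; apply. Qed.

Lemma absconvex_nbhs_absorbing T (U : set T) : nbhs (0 : T) U -> absorbing U.
Proof.
move=> nU x; have := @scale_continuous K T (0, x) U; rewrite /= scale0r.
move=> /(_ nU)[/= [D W] [/= D0 W0] DW].
move: D0; rewrite -nbhs_ballE => -[e /= e0 eD].
exists (e / 2); first by rewrite divr_gt0.
apply: (DW (e / 2, x)); split => /=; last exact: nbhs_singleton.
apply: eD; rewrite -ball_normE /= sub0r normrN gtr0_norm ?divr_gt0//.
by rewrite ltr_pdivrMr// mulr_natr mulr2n ltrDl.
Qed.

Lemma continuous_bounded_map T T' (f : {linear T -> T'}) : continuous f ->
  @bounded_map K (tvs_born T) (tvs_born T') f.
Proof.
move=> cf A bA; suff : tvs_bounded (f @` A) by [].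
move=> U /(continuous_linear0 cf)/bA[r r0 Ar]; exists r => //.
by move=> _ [x /Ar[y Uy <-] <-]; exists (f y) => //; rewrite linearZ.
Qed.

Definition cball (V : normedModType K) (r : K) : set V := [set v | `|v| <= r].
Arguments cball : clear implicits.

Lemma cball_bounded (V : normedModType K) (r : K) : 0 < r ->
  tvs_bounded (cball V r).
Proof.
move=> r0 U; rewrite -nbhs_ballE => -[e /= e0 eU].
exists (2 * r / e); first by rewrite divr_gt0// mulr_gt0.
move=> v vr; exists ((2 * r / e)^-1 *: v); last first.
  by rewrite scalerA divff ?scale1r// gt_eqF// divr_gt0// mulr_gt0.
apply: eU; rewrite -ball_normE /= sub0r normrN normrZ normfV.
rewrite gtr0_norm; last first.
  by rewrite divr_gt0// mulr_gt0.
rewrite mulrC ltr_pdivrMr; last by rewrite divr_gt0// mulr_gt0.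
rewrite [e * _]mulrC divfK ?gt_eqF// (le_lt_trans vr)//.
by rewrite mulr_natl mulr2n ltrDl.
Qed.

Lemma tvs_bounded_cball (V : normedModType K) (A : set V) : tvs_bounded A ->
  exists2 r : K, 0 < r & A `<=` cball V r.
Proof.
move=> /(_ _ (nbhsx_ballx (0 : V) 1 ltr01))[r r0 Ar]; exists r => //.
move=> _ /Ar[v v1 <-]; move: v1; rewrite -ball_normE /= sub0r normrN /cball /=.
by move=> v1; rewrite normrZ (gtr0_norm r0) ger_pMr// ltW.
Qed.

(** A disk neighbourhood absorbs the image of the unit ball, so its preimage
    contains a ball. *)
Lemma bounded_map_continuous (V : normedModType K) T (f : {linear V -> T}) :
  tvs_bounded (f @` cball V 1) -> continuous f.
Proof.
move=> bf; apply: linear_continuous0 => U nU.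
have [W [nW cW WU]] := absconvex_nbhs0 nU.
have [r r0 fW] := bf W nW.
have r'0 : 0 < r^-1 by rewrite invr_gt0.
rewrite -nbhs_ballE; exists r^-1 => //= v.
rewrite -ball_normE /= sub0r normrN => vr; apply: WU.
have /fW[w Ww rw] : (f @` cball V 1) (f (r *: v)).
  exists (r *: v) => //; rewrite /cball /= normrZ (gtr0_norm r0).
  by rewrite mulrC -ler_pdivlMr// div1r ltW.
suff -> : f v = w by [].
by apply: (scalerI (lt0r_neq0 r0)); rewrite rw linearZ.
Qed.

End LinearContinuity.
Arguments cball {K} V r _.

(** * The universal property of final topologies *)

Section FinalTheory.
Variables (K : numFieldType) (I : Type) (X : I -> tvsType K) (E : lmodType K).
Variable j : forall i, {linear X i -> E}.

Lemma final_continuous i : continuous (j i : X i -> final_tvs j).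
Proof.
apply: (@linear_continuous0 K (X i) (final_tvs j) (j i)).
move=> U /final_nbhs0E[V [_ _ nV] VU].
by apply: filterS (nV i) => x /VU.
Qed.

(** The preimage of a disk neighbourhood is automatically absorbing, so no
    condition beyond the continuity of the [h \o j i] remains. *)
Lemma final_universal (T : tvsType K) (h : {linear E -> T}) :
  (forall i, continuous (h \o j i)) -> continuous (h : final_tvs j -> T).
Proof.
move=> ch; apply: (@linear_continuous0 K (final_tvs j) T h) => U nU.
have [W [nW cW WU]] := absconvex_nbhs0 nU.
apply/final_nbhs0E; exists (h @^-1` W); last by move=> x /WU.
split.
- move=> a b x y Wx Wy ab; rewrite /preimage /= linearD !linearZ.
  exact: cW.
- move=> x; have [r r0 Wr] := absconvex_nbhs_absorbing nW (h x).
  by exists r => //; rewrite /preimage /= linearZ.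
- by move=> i; exact: (@continuous_linear0 _ _ _ (h \o j i)).
Qed.

End FinalTheory.

(** The final topology lives on E itself, not on an isomorphic copy; this is what
    turns equality of the families of bounded sets into equality of
    bornological spaces. *)
Lemma bvs_final_eq (K : numFieldType) (I : Type) (X : I -> tvsType K)
    (E : bvsType K) (j : forall i, {linear X i -> E}) :
  (forall A, bounded E A <-> tvs_bounded (A : set (final_tvs j))) ->
  E = tvs_born (final_tvs j).
Proof.
case: E j => E bnd ax /= j H; rewrite /tvs_born.
have {H}bndE : bnd = @tvs_bounded K (final_tvs j).
  by apply/funext => A; apply/propext.
(* E becomes convertible to the module underlying [final_tvs j] once it is
   destructed into a carrier and its operations. *)
move: (tvs_bounded_bornology _); case: E bnd ax j bndE => sE cE bnd ax j.
move=> bndE ax'; subst bnd.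
by rewrite (Prop_irrelevance ax ax').
Qed.

(** * Quotients of vector spaces *)

Record subspace (K : numFieldType) (E : lmodType K) := Subspace {
  subspace_set :> E -> Prop ;
  subspace0 : subspace_set 0 ;
  subspaceP : forall (a : K) x y,
    subspace_set x -> subspace_set y -> subspace_set (a *: x + y) }.

Section Quotient.
Local Open Scope quotient_scope.
Variables (K : numFieldType) (E : lmodType K) (U : subspace E).

Definition subspace_pred : {pred E} := fun x => `[< U x >].

Lemma subspace_zmod_closed : zmod_closed subspace_pred.
Proof.
split; first by apply/asboolP; exact: subspace0.
move=> x y /asboolP Ux /asboolP Uy; apply/asboolP.
by rewrite addrC -scaleN1r; exact: subspaceP.
Qed.

HB.instance Definition _ :=
  GRing.isZmodClosed.Build E subspace_pred subspace_zmod_closed.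

Definition quotient_space : Type := Quotient.quot (subspace_pred : zmodClosed E).

HB.instance Definition _ := GRing.Zmodule.on quotient_space.

Definition quotient_proj (x : E) : quotient_space :=
  \pi_(Quotient.quot (subspace_pred : zmodClosed E)) x.

Lemma quotient_projE x y : quotient_proj x = quotient_proj y <-> U (x - y).
Proof.
have H := Quotient.idealrBE subspace_pred x y.
split=> [xy|Uxy]; last by apply/eqP; rewrite -H; apply/asboolP.
by apply/asboolP; move: H; rewrite unfold_in => ->; apply/eqP.
Qed.

Lemma quotient_projK (x : quotient_space) : quotient_proj (repr x) = x.
Proof. exact: reprK. Qed.

Lemma quotient_projD x y :
  quotient_proj (x + y) = quotient_proj x + quotient_proj y.
Proof. exact: raddfD. Qed.

Definition quotient_scale (a : K) (x : quotient_space) : quotient_space :=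
  quotient_proj (a *: repr x).

Lemma quotient_projZ a x :
  quotient_scale a (quotient_proj x) = quotient_proj (a *: x).
Proof.
apply/quotient_projE; rewrite -scalerBr -[_ *: _]addr0; apply: subspaceP.
  by apply/quotient_projE; rewrite quotient_projK.
exact: subspace0.
Qed.

Lemma quotient_scaleA a b v :
  quotient_scale a (quotient_scale b v) = quotient_scale (a * b) v.
Proof. by rewrite -[v]quotient_projK !quotient_projZ scalerA. Qed.

Lemma quotient_scale1 : left_id 1 quotient_scale.
Proof. by move=> v; rewrite -[v]quotient_projK quotient_projZ scale1r. Qed.

Lemma quotient_scaleDr : right_distributive quotient_scale +%R.
Proof.
move=> a v w; rewrite -[v]quotient_projK -[w]quotient_projK.
by rewrite -quotient_projD !quotient_projZ -quotient_projD scalerDr.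
Qed.

Lemma quotient_scaleDl v :
  {morph quotient_scale^~ v : a b / a + b >-> a + b}.
Proof.
move=> a b; rewrite -[v]quotient_projK /=.
by rewrite !quotient_projZ -quotient_projD scalerDl.
Qed.

HB.instance Definition _ := GRing.Zmodule_isLmodule.Build K quotient_space
  quotient_scaleA quotient_scale1 quotient_scaleDr quotient_scaleDl.

Lemma quotient_proj_is_linear : linear quotient_proj.
Proof. by move=> a x y; rewrite quotient_projD -quotient_projZ. Qed.

HB.instance Definition _ := GRing.isLinear.Build K E quotient_space *:%R
  quotient_proj quotient_proj_is_linear.

Definition quotient_map : {linear E -> quotient_space} := quotient_proj.

Lemma quotient_map_eq0 x : quotient_map x = 0 <-> U x.
Proof.
have -> : 0 = quotient_map 0 by rewrite linear0.
by rewrite quotient_projE subr0.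
Qed.

End Quotient.

(** * An algebraic cocone with injective maps *)

Section DependentProduct.
Variables (K : numFieldType) (S : nat -> lmodType K).

Definition dprod : Type := forall n, S n.

HB.instance Definition _ := Choice.copy dprod (forall n, S n).

Let dadd (x y : dprod) : dprod := fun n => x n + y n.
Let dopp (x : dprod) : dprod := fun n => - x n.
Let dzero : dprod := fun n => 0.
Let dscale (a : K) (x : dprod) : dprod := fun n => a *: x n.

Let daddA : associative dadd.
Proof.
by move=> x y z; apply: functional_extensionality_dep => n; exact: addrA.
Qed.
Let daddC : commutative dadd.
Proof.
by move=> x y; apply: functional_extensionality_dep => n; exact: addrC.
Qed.
Let dadd0 : left_id dzero dadd.
Proof.
by move=> x; apply: functional_extensionality_dep => n; exact: add0r.
Qed.
Let daddN : left_inverse dzero dopp dadd.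
Proof.
by move=> x; apply: functional_extensionality_dep => n; exact: addNr.
Qed.

HB.instance Definition _ :=
  GRing.isZmodule.Build dprod daddA daddC dadd0 daddN.

Let dscaleA a b v : dscale a (dscale b v) = dscale (a * b) v.
Proof. by apply: functional_extensionality_dep => n; exact: scalerA. Qed.
Let dscale1 : left_id 1 dscale.
Proof.
by move=> v; apply: functional_extensionality_dep => n; exact: scale1r.
Qed.
Let dscaleDr : right_distributive dscale +%R.
Proof.
by move=> a v w; apply: functional_extensionality_dep => n; exact: scalerDr.
Qed.
Let dscaleDl v : {morph dscale^~ v : a b / a + b >-> a + b}.
Proof.
by move=> a b; apply: functional_extensionality_dep => n; exact: scalerDl.
Qed.

HB.instance Definition _ := GRing.Zmodule_isLmodule.Build K dprod
  dscaleA dscale1 dscaleDr dscaleDl.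

Lemma dprodP (a : K) (x y : dprod) n : (a *: x + y) n = a *: x n + y n.
Proof. by []. Qed.

End DependentProduct.

Section AlgebraicColimit.
Variables (K : numFieldType) (S : banach_seq K).

Let P := dprod (fun n => S n : lmodType K).

(** The sequence that is 0 below m, has value x at m, and follows the linking maps
    above m.  Adding [dfwith], which is zero off m, avoids any cast between the
    spaces S_n. *)
Fixpoint thread m (x : S m) n : S n :=
  if n is n'.+1 then dfwith (fun=> 0) x n'.+1 + link S n' (thread x n')
  else dfwith (fun=> 0) x 0%N.

Lemma dfwith_linear m n (a : K) (x y : S m) :
  dfwith (fun=> 0) (a *: x + y) n =
  a *: dfwith (fun=> 0) x n + dfwith (fun=> 0) y n :> S n.
Proof.
have [<-|mn] := eqVneq m n; first by rewrite !dfwith_in.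
by rewrite !dfwith_out// scaler0 addr0.
Qed.

Lemma thread_linear m n (a : K) (x y : S m) :
  thread (a *: x + y) n = a *: thread x n + thread y n.
Proof.
elim: n => [|n IH] /=; first exact: dfwith_linear.
by rewrite IH dfwith_linear linearD linearZ scalerDr addrACA.
Qed.

Lemma thread_lt m n (x : S m) : (n < m)%N -> thread x n = 0.
Proof.
elim: n => [|n IH] nm /=; first by rewrite dfwith_out// gtn_eqF.
by rewrite dfwith_out ?gtn_eqF// IH ?linear0 ?addr0// ltnW.
Qed.

Lemma thread_eq m (x : S m) : thread x m = x.
Proof.
case: m x => [|m] x /=; first by rewrite dfwith_in.
by rewrite dfwith_in thread_lt// linear0 addr0.
Qed.

Lemma thread_ge m n (x : S m) : (m <= n)%N ->
  thread x n.+1 = link S n (thread x n).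
Proof. by move=> mn /=; rewrite dfwith_out ?add0r// ltn_eqF. Qed.

Lemma thread_link m n (x : S m) : (m < n)%N ->
  thread (link S m x) n = thread x n.
Proof.
elim: n => [//|n IH]; rewrite ltnS leq_eqVlt => /orP[/eqP mn|mn].
  by rewrite -mn thread_eq thread_ge// thread_eq.
by rewrite !thread_ge ?IH// ltnW.
Qed.

Lemma thread_eq0 m n (x : S m) : (m <= n)%N -> thread x n = 0 -> x = 0.
Proof.
elim: n => [|n IH].
  by rewrite leqn0 => /eqP m0; subst m; rewrite thread_eq.
rewrite leq_eqVlt => /orP[/eqP mn|mn].
  by subst m; rewrite thread_eq.
rewrite thread_ge// => h; apply: IH => //.
by apply: (@link_injective _ S n); rewrite h linear0.
Qed.

Definition eventually_zero_set : set P :=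
  [set x | exists N, forall n, (N <= n)%N -> x n = 0].

Lemma eventually_zero0 : eventually_zero_set 0.
Proof. by exists 0%N. Qed.

Lemma eventually_zeroP (a : K) x y : eventually_zero_set x ->
  eventually_zero_set y -> eventually_zero_set (a *: x + y).
Proof.
move=> [N xN] [M yM]; exists (maxn N M) => n; rewrite geq_max => /andP[Nn Mn].
by rewrite dprodP xN// yM// scaler0 addr0.
Qed.

Definition eventually_zero := Subspace eventually_zero0 eventually_zeroP.

(** This is larger than the algebraic colimit, which it contains; it is only used
    as a target that separates the points of each S_n. *)
Definition alg_colim : lmodType K := quotient_space eventually_zero.

Definition alg_in m (x : S m) : alg_colim :=
  quotient_map eventually_zero (thread x).

Lemma alg_in_is_linear m : linear (@alg_in m).
Proof.
move=> a x y; rewrite /alg_in -linearP; congr (quotient_map _ _).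
by apply: functional_extensionality_dep => n; exact: thread_linear.
Qed.

HB.instance Definition _ m := GRing.isLinear.Build K (S m) alg_colim *:%R
  (@alg_in m) (@alg_in_is_linear m).

Definition alg_incl m : {linear S m -> alg_colim} := @alg_in m.

Lemma alg_incl_cocone : cocone alg_incl.
Proof.
move=> n x; apply/quotient_projE; exists n.+1 => m nm.
have := @dprodP K (fun n => S n : lmodType K) (-1)
  (thread x) (thread (link S n x)) m.
by rewrite scaleN1r addrC => ->; rewrite scaleN1r thread_link// addNr.
Qed.

Lemma alg_incl_injective m : injective (alg_incl m).
Proof.
apply: raddf_inj => x /(quotient_map_eq0 eventually_zero)[N xN].
apply: (@thread_eq0 m (maxn m N)); first exact: leq_maxl.
by apply: xN; exact: leq_maxr.
Qed.

End AlgebraicColimit.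

(** * Colimits as increasing unions *)

Section Unions.
Variables (K : numFieldType) (S : banach_seq K).
Implicit Types (F : lmodType K) (T : tvsType K).

Definition is_union F (j : forall n, {linear S n -> F}) :=
  [/\ cocone j, forall n, injective (j n) & forall x, exists n y, j n y = x].

Lemma link_le n m : (n <= m)%N -> exists f : {linear S n -> S m},
  continuous f /\ forall F (j : forall n, {linear S n -> F}), cocone j ->
    forall x, j m (f x) = j n x.
Proof.
elim: m => [|m IH].
  rewrite leqn0 => /eqP n0; subst n.
  by exists (@idfun (S 0%N)); split => // x; exact: cvg_id.
rewrite leq_eqVlt => /orP[/eqP nm|nm].
  by subst n; exists (@idfun (S m.+1)); split => // x; exact: cvg_id.
have [f [cf fj]] := IH nm; exists (link S m \o f); split.
  by move=> x; apply: continuous_comp; [exact: cf|exact: link_continuous].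
by move=> F j cj x /=; rewrite cj fj.
Qed.

Lemma union_common F (j : forall n, {linear S n -> F}) n m (x : S n) (y : S m) :
  cocone j -> exists N (x' : S N) (y' : S N), j N x' = j n x /\ j N y' = j m y.
Proof.
move=> cj; have [f [_ fj]] := link_le (leq_maxl n m).
have [g [_ gj]] := link_le (leq_maxr n m).
by exists (maxn n m), (f x), (g y); rewrite fj// gj.
Qed.

(** Each x of F has a preimage at some level; its image under [j'] depends neither
    on the level nor on the preimage, because two preimages become equal at a
    common level by injectivity. *)
Lemma union_lift F F' (j : forall n, {linear S n -> F})
    (j' : forall n, {linear S n -> F'}) : is_union j -> cocone j' ->
  exists h : {linear F -> F'}, forall n x, h (j n x) = j' n x.
Proof.
move=> [cj ij sj] cj'.
have wd n m (x : S n) (y : S m) : j n x = j m y -> j' n x = j' m y.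
  have [f [_ fj]] := link_le (leq_maxl n m).
  have [g [_ gj]] := link_le (leq_maxr n m).
  rewrite -(fj _ j)// -(gj _ j)// => /ij fg.
  by rewrite -(fj _ j')// -(gj _ j')// fg.
have /choice[h hP] : forall x, exists z, forall n y, j n y = x -> j' n y = z.
  move=> x; have [n [y yx]] := sj x; exists (j' n y) => m z zx.
  by apply: wd; rewrite zx.
have hL : linear h.
  move=> a x y; have [n [u <-]] := sj x; have [m [v <-]] := sj y.
  have [N [u' [v' [<- <-]]]] := union_common u v cj.
  by rewrite -linearP -!(hP _ _ _ erefl) linearP.
pose hM := GRing.isLinear.Build K F F' *:%R h hL.
pose h' : {linear F -> F'} := HB.pack h hM.
by exists h' => n x /=; rewrite -(hP _ n x erefl).
Qed.

Section UnionSubspace.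
Variables (F : lmodType K) (j : forall n, {linear S n -> F}) (cj : cocone j).

Let union_set x := exists n y, j n y = x.

Let union0 : union_set 0.
Proof. by exists 0%N, 0; rewrite linear0. Qed.

Let unionP (a : K) x y : union_set x -> union_set y -> union_set (a *: x + y).
Proof.
move=> [n [u <-]] [m [v <-]]; have [N [u' [v' [<- <-]]]] := union_common u v cj.
by exists N, (a *: u' + v'); rewrite linearP.
Qed.

Definition union_subspace : subspace F := Subspace union0 unionP.

End UnionSubspace.

(** Injectivity: the colimit maps to [alg_colim], where the S_n embed.
    Surjectivity: the quotient map by the union U of the images and the zero map
    are continuous into the quotient and agree on every S_n, so they are equal. *)
Lemma tc_colim_union T (j : forall n, {linear S n -> T}) :
  is_colim_tc j -> is_union j.
Proof.
move=> [[cj ctj] univ]; split => //.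
- move=> n; pose C := final_tvs (X := fun n => S n) (@alg_incl K S).
  have cc : tc_cocone (T := C) (@alg_incl K S).
    split; first exact: alg_incl_cocone.
    move=> m; exact (@final_continuous K nat (fun n => S n) _ (@alg_incl K S) m).
  have [h [_ hj _]] := univ _ _ cc.
  by move=> x y xy; apply: (@alg_incl_injective K S); rewrite -!hj xy.
- pose U := union_subspace cj; pose q := quotient_map U.
  pose Q := final_tvs (fun _ : unit => quotient_map U).
  have cc : @tc_cocone K S Q (fun n => \0).
    by split => // n; exact: cst_continuous.
  have [h [_ _ hP]] := univ _ _ cc.
  have q0 : (q : T -> Q) =1 h.
    apply: (hP (quotient_map U)).
      exact (@final_continuous K unit (fun=> T) _ (fun=> quotient_map U) tt).
    by move=> n x; apply/quotient_map_eq0; exists n, x.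
  have z0 : (\0 : T -> Q) =1 h.
    by apply: (hP \0) => //; exact: cst_continuous.
  by move=> x; apply/(quotient_map_eq0 U); rewrite [LHS]q0 -z0.
Qed.

Lemma coarse_bornology F : convex_bornology (fun _ : set F => True).
Proof. by split => // x; exists setT. Qed.

Definition coarse_bvs F : bvsType K := BvsType F _ (coarse_bornology F).

(** As for topological colimits; every map into a coarse bornology is bounded. *)
Lemma born_colim_union (F : bvsType K)
    (j : forall n, {linear tvs_born (S n) -> F}) :
  is_colim_born j -> @is_union F j.
Proof.
move=> [[cj bj] univ]; split => //.
- move=> n; have cc : @born_cocone K S (coarse_bvs (alg_colim S)) (@alg_incl K S).
    by split; [exact: alg_incl_cocone|].
  have [h [_ hj _]] := univ _ _ cc.
  by move=> x y xy; apply: (@alg_incl_injective K S); rewrite -!hj xy.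
- pose U := @union_subspace F j cj; pose q := quotient_map U.
  pose Q := coarse_bvs (quotient_space U).
  have cc : @born_cocone K S Q (fun n => \0) by split.
  have [h [_ _ hP]] := univ _ _ cc.
  have q0 : (q : F -> Q) =1 h.
    by apply: (hP (quotient_map U)) => // n x; apply/quotient_map_eq0; exists n, x.
  have z0 : (\0 : F -> Q) =1 h by exact: (hP \0).
  by move=> x; apply/(quotient_map_eq0 U); rewrite [LHS]q0 -z0.
Qed.

Lemma union_final_colim F (j : forall n, {linear S n -> F}) :
  is_union j -> @is_colim_tc K S (final_tvs (X := fun n => S n) j) j.
Proof.
move=> uj; have [cj ij sj] := uj; split.
  by split => // n; exact (@final_continuous K nat (fun n => S n) F j n).
move=> T' j' [cj' ctj']; have [h hj] := union_lift uj cj'.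
exists h; split => //.
  apply: (final_universal (X := fun n => S n) (j := j)) => n x.
  rewrite /continuous_at /= hj.
  rewrite (_ : (h \o j n) = j' n)//; first exact: ctj'.
  by apply/funext => y /=; rewrite hj.
move=> h' _ h'j x; have [n [y <-]] := sj x.
by rewrite [LHS]h'j hj.
Qed.

Definition union_bounded F (j : forall n, {linear S n -> F}) (A : set F) :=
  exists n, exists2 r : K, 0 < r & A `<=` j n @` cball (S n) r.

Lemma union_bounded_common F (j : forall n, {linear S n -> F}) A B :
  cocone j -> union_bounded j A -> union_bounded j B ->
  exists n, exists2 r : K, 0 < r &
    A `<=` j n @` cball (S n) r /\ B `<=` j n @` cball (S n) r.
Proof.
move=> cj [n [r r0 Ar]] [m [s s0 Bs]].
have [f [cf fj]] := link_le (leq_maxl n m).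
have [g [cg gj]] := link_le (leq_maxr n m).
have [r' r'0 fr] := tvs_bounded_cball
  (continuous_bounded_map cf (cball_bounded r0)).
have [s' s'0 gs] := tvs_bounded_cball
  (continuous_bounded_map cg (cball_bounded s0)).
exists (maxn n m), (r' + s'); first exact: addr_gt0.
split.
  move=> _ /Ar[x xr <-]; exists (f x); last by rewrite fj.
  have /fr : (f @` cball (S n) r) (f x) by exists x.
  by rewrite /cball /= => /le_trans; apply; rewrite lerDl ltW.
move=> _ /Bs[x xs <-]; exists (g x); last by rewrite gj.
have /gs : (g @` cball (S m) s) (g x) by exists x.
by rewrite /cball /= => /le_trans; apply; rewrite lerDr ltW.
Qed.

Lemma cball_absconvex (V : normedModType K) (r : K) :
  0 <= r -> absolutely_convex (cball V r).
Proof.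
move=> r0 a b x y; rewrite /cball /= => xr yr ab.
rewrite (le_trans (ler_normD _ _))// !normrZ.
have ax := ler_wpM2l (normr_ge0 a) xr; have by_ := ler_wpM2l (normr_ge0 b) yr.
by rewrite (le_trans (lerD ax by_))// -mulrDl ler_piMl.
Qed.

Lemma absconvex_image F F' (f : {linear F -> F'}) (A : set F) :
  absolutely_convex A -> absolutely_convex (f @` A).
Proof.
move=> cA a b _ _ [x Ax <-] [y Ay <-] ab; exists (a *: x + b *: y).
  exact: cA.
by rewrite linearD !linearZ.
Qed.

Lemma union_bornology F (j : forall n, {linear S n -> F}) :
  is_union j -> convex_bornology (union_bounded j).
Proof.
move=> [cj ij sj]; split.
- move=> x; have [n [y yx]] := sj x; exists [set x] => //.
  exists n, (`|y| + 1); first by rewrite ltr_wpDl.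
  by move=> _ ->; exists y => //; rewrite /cball /= lerDl.
- by move=> A B AB [n [r r0 Br]]; exists n, r => // x /AB/Br.
- move=> A B bA bB; have [n [r r0 [Ar Br]]] := union_bounded_common cj bA bB.
  by exists n, r => // x [/Ar|/Br].
- move=> A B bA bB; have [n [r r0 [Ar Br]]] := union_bounded_common cj bA bB.
  exists n, (r + r); first exact: addr_gt0.
  move=> _ [x /Ar[u ur <-]] [y /Br[v vr <-]] <-; exists (u + v).
    by rewrite /cball /= (le_trans (ler_normD _ _))// lerD.
  by rewrite linearD.
- move=> c A [n [r r0 Ar]]; exists n, (`|c| * r + r).
    by rewrite ltr_wpDl// mulr_ge0// ltW.
  move=> _ [x /Ar[u ur <-] <-]; exists (c *: u); last by rewrite linearZ.
  rewrite /cball /= normrZ (le_trans (ler_wpM2l (normr_ge0 c) ur))//.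
  by rewrite lerDl ltW.
- move=> A [n [r r0 Ar]]; exists n, r => // x; apply; split => //.
  by apply: absconvex_image; apply: cball_absconvex; rewrite ltW.
Qed.

Definition union_bvs F (j : forall n, {linear S n -> F}) (uj : is_union j) :
  bvsType K := BvsType F (union_bounded j) (union_bornology uj).

Lemma union_bounded_map F (j : forall n, {linear S n -> F}) (uj : is_union j) n :
  @bounded_map K (tvs_born (S n)) (union_bvs uj) (j n).
Proof.
move=> A /tvs_bounded_cball[r r0 Ar]; exists n, r => //.
by move=> _ [x /Ar xr <-]; exists x.
Qed.

(** The images of balls generate a bornology on F that also receives the cocone;
    the comparison map given by the universal property is the identity on each
    S_n, hence everywhere. *)
Lemma born_colim_bounded (F : bvsType K)
    (j : forall n, {linear tvs_born (S n) -> F}) : is_colim_born j ->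
  forall A, bounded F A <-> @union_bounded F j A.
Proof.
move=> cF; have uj := born_colim_union cF; have [_ _ sj] := uj.
have [[cj bj] univ] := cF => A; split; last first.
  move=> [n [r r0 Ar]]; apply: (bnd_subset (bvs_axioms F) Ar).
  exact/bj/cball_bounded.
have cc : @born_cocone K S (union_bvs uj) j.
  by split => // n; exact: union_bounded_map.
have [h [bh hj _]] := univ _ _ cc.
move=> /bh; suff -> : h @` A = A by [].
have hid x : h x = x by have [n [y <-]] := sj x; rewrite hj.
by apply/seteqP; split=> [_ [x Ax <-]|x Ax]; [rewrite hid|exists x].
Qed.

Lemma union_born_colim (F : bvsType K)
    (j : forall n, {linear tvs_born (S n) -> F}) : @is_union F j ->
  (forall A, bounded F A <-> @union_bounded F j A) -> is_colim_born j.
Proof.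
move=> uj bF; have [cj ij sj] := uj; split.
  by split => // n A bA; apply/bF; exact: (union_bounded_map uj).
move=> F' j' [cj' bj']; have [h hj] := union_lift uj cj'.
exists h; split => //.
  move=> A /bF[n [r r0 Ar]].
  apply: (bnd_subset (bvs_axioms F') (B := j' n @` cball (S n) r)).
    by move=> _ [x /Ar[y yr <-] <-]; exists y.
  exact/bj'/cball_bounded.
by move=> h' _ h'j x; have [n [y <-]] := sj x; rewrite h'j hj.
Qed.

End Unions.

(** * Transport along isomorphisms *)

Section Transport.
Variable K : numFieldType.

(** The final topology of the single map g : T -> E is the image of the topology
    of T under the isomorphism. *)
Lemma isomorphic_tvs_born (E : bvsType K) (T : tvsType K) :
  bvs_isomorphic E (tvs_born T) -> exists T' : tvsType K, E = tvs_born T'.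
Proof.
move=> [f [g [fK gK bf bg]]].
pose X := fun _ : unit => T.
pose j := (fun _ => g) : forall i, {linear X i -> E}.
exists (final_tvs j); apply: bvs_final_eq => A; split.
- move=> /bf bfA.
  have -> : A = g @` (f @` A).
    apply/seteqP; split=> [x Ax|_ [_ [x Ax <-] <-]]; last by rewrite fK.
    by exists (f x); [exists x|rewrite fK].
  have cg : continuous (g : T -> final_tvs j) := @final_continuous K unit X E j tt.
  exact (continuous_bounded_map cg bfA).
- have cf : continuous (f : final_tvs j -> T).
    apply: final_universal => -[]; rewrite (_ : f \o j tt = id).
      by move=> x; exact: cvg_id.
    by apply/funext => x; exact: gK.
  move=> bA; have bfA : bounded (tvs_born T) (f @` A).
    exact (@continuous_bounded_map K (final_tvs j) T f cf A bA).
  have := bg _ bfA; rewrite image_comp.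
  rewrite (_ : g \o f = id) ?image_id//.
  by apply/funext => x; exact: fK.
Qed.

Lemma LBb_union (E : bvsType K) : LBb E ->
  exists (S : banach_seq K) (j : forall n, {linear S n -> E}),
    is_union j /\ forall A, bounded E A <-> union_bounded j A.
Proof.
move=> [S [F [j [cF [f [g [fK gK bf bg]]]]]]].
have [cj ij sj] := born_colim_union cF.
have bF := born_colim_bounded cF.
exists S, (fun n => g \o j n); split; first split.
- by move=> n x /=; rewrite cj.
- by move=> n; apply: inj_comp; [exact: can_inj gK|exact: ij].
- by move=> x; have [n [y yx]] := sj (f x); exists n, y; rewrite /= yx fK.
move=> A; split.
  move=> /bf/bF[n [r r0 fA]]; exists n, r => // x Ax.
  have /fA[y yr yx] : (f @` A) (f x) by exists x.
  by exists y => //=; rewrite yx fK.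
move=> [n [r r0 Ar]].
apply: (bnd_subset (bvs_axioms E) (B := g @` (j n @` cball (S n) r))).
  by move=> _ /Ar[y yr <-]; exists (j n y) => //; exists y.
by apply: bg; apply/bF; exists n, r.
Qed.

End Transport.

(** * Balls as Banach disks *)

Section Minkowski.
Variable K : numFieldType.

Lemma infimumP (A : set K) (m : K) : A !=set0 -> lbound A m ->
  (forall y, lbound A y -> y <= m) -> infimum 0 A = m.
Proof.
move=> A0 mA mP; rewrite /infimum; case: eqP => [A00|_].
  by move: A0; rewrite A00 => -[].
have h : infimums A m by split => // y yA; exact: mP.
have [yA yP] := xgetI 0 h.
by apply/eqP; rewrite eq_le mP// yP.
Qed.

Lemma lt0_lbound (y : K) : (forall l, 0 < l -> y <= l) -> y <= 0.
Proof.
move=> yP; have y1 := yP 1 ltr01.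
have yR : y \is Num.real.
  by rewrite -(subrK 1 y) realD// ler0_real// subr_le0.
rewrite real_leNgt//; apply/negP => y0.
have := yP (y / 2) (divr_gt0 y0 (ltr0n _ 2)).
rewrite ler_pdivlMr// mulr_natr mulr2n gerDl => /(lt_le_trans y0).
by rewrite ltxx.
Qed.

(** The normed space spanned by f(ball of radius r) is V itself with its norm,
    embedded by r f: the Minkowski functional of the ball of radius r is the norm
    divided by r. *)
Lemma banach_disk_image (E : lmodType K) (V : completeNormedModType K)
    (f : {linear V -> E}) (r : K) : injective f -> 0 < r ->
  banach_disk (f @` cball V r).
Proof.
move=> If r0; have rn0 := lt0r_neq0 r0; split.
  by apply: absconvex_image; apply: cball_absconvex; rewrite ltW.
pose g : {linear V -> E} := f \o ( *:%R r).
exists V, g; split.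
- by move=> x y /If /(scalerI rn0).
- apply/seteqP; split=> [_ [v _ <-]|_ [n [c [e [eB ->]]]]].
    (* The weight |v| + 1 instead of |v| also covers v = 0. *)
    exists 1%N, (fun=> `|v| + 1), (fun=> f ((r / (`|v| + 1)) *: v)).
    have v1 : 0 < `|v| + 1 by rewrite ltr_wpDl.
    split.
      move=> _; exists ((r / (`|v| + 1)) *: v) => //.
      rewrite /cball /= normrZ gtr0_norm ?divr_gt0//.
      by rewrite mulrAC ler_pdivrMr// ler_pM2l// lerDl.
    by rewrite big_ord1 -linearZ scalerA mulrCA divff ?mulr1// gt_eqF.
  have /choice[w wP] : forall i, exists w, f w = e i.
    by move=> i; have [w _ wE] := eB i; exists w.
  exists (r^-1 *: \sum_i c i *: w i) => //=.
  rewrite scalerA divff// scale1r linear_sum; apply: eq_bigr => i _.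
  by rewrite linearZ wP.
- move=> v; apply/esym; apply: infimumP.
  + exists (`|v| + 1); split; first by rewrite ltr_wpDl.
    have v1 : 0 < `|v| + 1 by rewrite ltr_wpDl.
    exists (f ((`|v| + 1)^-1 *: (r *: v))).
      exists ((`|v| + 1)^-1 *: (r *: v)) => //.
      rewrite /cball /= !normrZ normfV !gtr0_norm// mulrC ler_pdivrMr//.
      by rewrite ler_pM2l// lerDl.
    by rewrite -linearZ scalerA divff ?scale1r// gt_eqF.
  + move=> l [l0 [_ [w wr <-]]] /=; rewrite -linearZ => /If lw.
    have : `|l *: w| <= l * r by rewrite normrZ (gtr0_norm l0) ler_pM2l.
    by rewrite lw normrZ (gtr0_norm r0) mulrC ler_pM2r.
  + move=> y yP; have [v0|v0] := eqVneq v 0.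
      rewrite v0 normr0; apply: lt0_lbound => l l0; apply: yP; split => //.
      exists 0; last by rewrite v0 scaler0 linear0.
      exists 0; last by rewrite linear0.
      by rewrite /cball /= normr0 ltW.
    have nv0 : 0 < `|v| by rewrite normr_gt0.
    apply: yP; split=> //; exists (f (`|v|^-1 *: (r *: v))).
      exists (`|v|^-1 *: (r *: v)) => //.
      rewrite /cball /= !normrZ normfV normr_id (gtr0_norm r0).
      by rewrite mulrCA mulVf ?mulr1// gt_eqF.
    by rewrite -linearZ scalerA divff ?scale1r// gt_eqF.
Qed.

End Minkowski.

(** * From bornological to topological colimits *)

(** The final topology of the colimit cocone has the same bounded sets as T: it is
    finer than T, and the sets bounded in E are covered by images of balls. *)
Lemma LBb_CBorn_LB (K : numFieldType) (E : bvsType K) (T : tvsType K) :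
  LBb E -> E = tvs_born T ->
  CBorn E /\ exists2 T' : tvsType K, LB_space T' & E = tvs_born T'.
Proof.
move=> /LBb_union[S [j [uj bE]]] ET; subst E; have [cj ij sj] := uj.
split.
  move=> A /bE[n [r r0 Ar]]; exists (j n @` cball (S n) r); split => //.
    by apply/bE; exists n, r.
  exact: banach_disk_image.
pose X n : tvsType K := S n.
pose j' : forall n, {linear X n -> tvs_born T} := j.
have cj' n : continuous (j' n : X n -> final_tvs j').
  exact (@final_continuous K nat X _ j' n).
exists (final_tvs j'); first by exists S, j; exact: union_final_colim.
apply: bvs_final_eq => A; split.
  move=> /bE[n [r r0 Ar]].
  have b : tvs_bounded (j' n @` cball (S n) r : set (final_tvs j')).
    exact (@continuous_bounded_map K (X n) (final_tvs j') (j' n) (cj' n) _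
      (cball_bounded r0)).
  exact (bnd_subset (tvs_bounded_bornology (final_tvs j')) Ar b).
have ci : continuous (@idfun T : final_tvs j' -> T).
  apply: final_universal => n.
  apply: (@bounded_map_continuous K (S n) T (j n)).
  by apply/bE; exists n, 1.
move=> bA; have := @continuous_bounded_map K (final_tvs j') T idfun ci A bA.
by rewrite image_id.
Qed.

(** * Completeness over Archimedean scalars *)

Definition archimedean_norm (K : numFieldType) :=
  forall e : K, 0 < e -> exists n : nat, n.+1%:R^-1 < e.

Lemma real_archimedean_norm (R : realType) : archimedean_norm R.
Proof.
move=> e e0; exists (Num.truncn e^-1).
by rewrite -ltf_pV2 ?posrE ?invr_gt0// invrK truncnS_gt.
Qed.

Lemma complex_archimedean_norm (R : realType) : archimedean_norm R[i].
Proof.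
move=> e e0; have /complex_realP[a ea] := gtr0_real e0.
move: e0; rewrite ea -[0]/(0%:C)%C ltcR => /real_archimedean_norm[n na].
by exists n; rewrite -(rmorph_nat (@real_complex R)) -fmorphV /= ltcR.
Qed.

Section Completeness.
Variables (K : numFieldType) (archK : archimedean_norm K).

Lemma dyadic_small (c e : K) : 0 < c -> 0 < e ->
  exists n, c * 2^-1 ^+ n < e.
Proof.
move=> c0 e0; have [n ne] := archK (divr_gt0 e0 c0).
exists n; rewrite mulrC -ltr_pdivlMr// (le_lt_trans _ ne)//.
rewrite exprVn lef_pV2 ?posrE ?exprn_gt0//.
by rewrite -natrX ler_nat ltn_expl.
Qed.

Lemma halving_small (r : nat -> K) : 0 < r 0%N ->
  (forall n, r n.+1 <= 2^-1 * r n) -> forall e, 0 < e -> exists n, r n < e.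
Proof.
move=> r0 rS e e0; have [n ne] := dyadic_small r0 e0.
exists n; apply: le_lt_trans ne.
elim: n => [|n IH]; first by rewrite expr0 mulr1.
by rewrite (le_trans (rS n))// exprS mulrCA ler_pM2l// invr_gt0.
Qed.

Lemma le_addgt0 (x y : K) : 0 <= x -> 0 <= y ->
  (forall e, 0 < e -> x < e + y) -> x <= y.
Proof.
move=> x0 y0 xy; rewrite real_leNgt ?ger0_real//; apply/negP => yx.
by have := xy (x - y); rewrite subr_gt0 yx subrK ltxx => /(_ isT).
Qed.

(** The closed balls of centre [a n] and radius [r n] are nested, and the bound on
    the steps telescopes to |a m - a n| <= r n for m >= n; this serves both
    Baire's theorem and the summation of geometric series. *)
Lemma cvg_telescope (V : completeNormedModType K) (a : nat -> V) (r : nat -> K) :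
  (forall n, 0 <= r n) -> (forall n, `|a n.+1 - a n| <= r n - r n.+1) ->
  (forall e, 0 < e -> exists n, r n < e) ->
  exists l, forall n, `|l - a n| <= r n.
Proof.
move=> r0 ar rS.
have tel n k : `|a (k + n)%N - a n| <= r n - r (k + n)%N.
  elim: k => [|k IH]; first by rewrite !subrr normr0.
  rewrite -(subrKA (a (k + n)%N)) (le_trans (ler_normD _ _))//.
  have -> : r n - r (k.+1 + n)%N =
      r (k + n)%N - r (k.+1 + n)%N + (r n - r (k + n)%N).
    by rewrite [RHS]addrC subrKA.
  by apply: lerD; [exact: ar|exact: IH].
have tel' n m : (n <= m)%N -> `|a m - a n| <= r n.
  move=> nm; rewrite -(subnK nm) (le_trans (tel _ _))//.
  by rewrite lerBlDr lerDl.
have /cvg_ex[l al] : cvg (a @ \oo).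
  apply: cauchy_cvg; apply: cauchy_exP => e e0.
  have [n ne] := rS _ e0; exists (a n); rewrite /fmapE -ball_normE.
  exists n => // m /= nm; rewrite /ball_ /= distrC.
  by rewrite (le_lt_trans (tel' _ _ nm)).
exists l => n; apply: le_addgt0 => // e e0.
have [N _ NP] := (cvgrPdist_lt _ _).1 al e e0.
rewrite -(subrKA (a (maxn n N))) (le_lt_trans (ler_normD _ _))//.
apply: ltr_leD; first by apply: NP; exact: leq_maxr.
by apply: tel'; exact: leq_maxl.
Qed.

(** Baire's theorem: one of countably many sets covering a Banach space is dense
    in some ball.  Otherwise each ball of radius r contains a ball of radius at
    most r / 2 missing D k; iterating over k gives nested balls, whose common
    point lies in none of the D k. *)
Lemma nonmeager (V : completeNormedModType K) (D : nat -> set V) :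
  (forall v, exists k, D k v) ->
  exists k (a : V) (r : K), 0 < r /\
    forall v, `|v - a| <= r -> forall e, 0 < e -> exists2 d, D k d & `|v - d| < e.
Proof.
move=> coverD; apply: contrapT => noball.
have step (k : nat) (ar : V * {posnum K}) : exists bs : V * {posnum K},
    [/\ `|bs.1 - ar.1| <= 2^-1 * ar.2%:num,
        bs.2%:num <= 2^-1 * ar.2%:num &
        forall d, D k d -> bs.2%:num < `|bs.1 - d|].
  case: ar => a r; apply: contrapT => nostep; apply: noball.
  exists k, a, (2^-1 * r%:num); split => // v va e e0.
  apply: contrapT => nod; apply: nostep.
  (* A positive number below both e and r / 2, without comparing e and r. *)
  have s0 : 0 < e * r%:num / (e + r%:num) / 2.
    by rewrite !divr_gt0 ?mulr_gt0 ?addr_gt0.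
  exists (v, PosNum s0); split => //=.
    rewrite mulrC ler_pM2l ?invr_gt0// ler_pdivrMr ?addr_gt0//.
    by rewrite mulrDr [e * _]mulrC lerDl mulr_ge0.
  move=> d Dd; apply: (@lt_le_trans _ _ e).
    have er0 : 0 < e + r%:num by rewrite addr_gt0.
    rewrite ltr_pdivrMr// ltr_pdivrMr// -mulrA ltr_pM2l//.
    rewrite mulr_natl mulr2n -addrA addrCA ltrDl.
    by rewrite !addr_gt0.
  rewrite real_leNgt ?normr_real ?(gtr0_real e0)//.
  by apply/negP => vd; apply: nod; exists d.
have [f fP] := choice (fun kar : nat * (V * {posnum K}) => step kar.1 kar.2).
pose fix ar n : V * {posnum K} :=
  if n is k.+1 then f (k, ar k) else (0, PosNum (@ltr01 K)).
have arP n := fP (n, ar n).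
have [l lP] : exists l, forall n, `|l - (ar n).1| <= (ar n).2%:num.
  apply: cvg_telescope => // [n|].
    have [h1 h2 _] := arP n.
    rewrite (le_trans h1)// lerBrDr -lerBrDl (le_trans h2)//.
    by rewrite lerBrDr -mulrDl -mulr2n -[2^-1 *+ 2]mulr_natr mulVf ?mul1r//.
  apply: halving_small => // n.
  by have [_ h2 _] := arP n.
have [k Dk] := coverD l; have [_ _ /(_ _ Dk)] := arP k.
by rewrite distrC => /lt_le_trans/(_ (lP k.+1)); rewrite ltxx.
Qed.

End Completeness.

(** * Successive approximation *)

Section Factorization.
Variables (K : numFieldType) (archK : archimedean_norm K).
Variables (T : tvsType K) (V W : completeNormedModType K).
Variables (f : {linear V -> T}) (g : {linear W -> T}).
Hypotheses (cf : continuous f) (cg : continuous g).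
Hypothesis sepT : forall x : T, (forall U, nbhs (0 : T) U -> U x) -> x = 0.

Lemma nbhs0_cball (X : normedModType K) (U : set X) : nbhs (0 : X) U ->
  exists2 e : K, 0 < e & forall v, `|v| < e -> U v.
Proof.
rewrite -nbhs_ballE => -[e /= e0 eU]; exists e => // v ve; apply: eU.
by rewrite -ball_normE /= sub0r normrN.
Qed.

(** The part of the open mapping theorem that removes a closure.  The hypothesis
    says that g(ball of radius m) meets f(V) in a set whose preimage is dense in
    the ball of radius e.  Halving the error at each step writes f v as g of a
    partial sum plus a remainder f (u n), with u n of norm at most e / 2^n; the
    sums converge in W, and T being separated the limit w satisfies f v = g w. *)
Lemma approximate_lift (m e : K) : 0 < m -> 0 < e ->
  (forall v, `|v| <= e -> forall d, 0 < d ->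
    exists v' w, [/\ `|v - v'| < d, `|w| <= m & f v' = g w]) ->
  forall v, `|v| <= e -> exists2 w, `|w| <= 2 * m & f v = g w.
Proof.
move=> m0 e0 approx v ve.
have h0 n : 0 < 2^-1 ^+ n :> K by rewrite exprn_gt0// invr_gt0.
have step (n : nat) (u : V) : exists uw : V * W, `|u| <= e * 2^-1 ^+ n ->
    [/\ `|uw.1| <= e * 2^-1 ^+ n.+1, `|uw.2| <= m * 2^-1 ^+ n &
        f u = g uw.2 + f uw.1].
  have [ue|ue] := boolP (`|u| <= e * 2^-1 ^+ n); last by exists (0, 0).
  have nu : `|2 ^+ n *: u| <= e.
    rewrite normrZ gtr0_norm ?exprn_gt0// mulrC -ler_pdivlMr ?exprn_gt0//.
    by rewrite -exprVn.
  have [v' [w [uv wm fg]]] := approx _ nu (e / 2) (divr_gt0 e0 (ltr0n _ 2)).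
  have n20 : 2 ^+ n != 0 :> K by rewrite expf_neq0// pnatr_eq0.
  exists (u - 2^-1 ^+ n *: v', 2^-1 ^+ n *: w) => _ /=; split.
  - rewrite -[u](scalerK n20) -exprVn -scalerBr normrZ gtr0_norm//.
    by rewrite exprS mulrA [leRHS]mulrC ler_pM2l// ltW.
  - by rewrite normrZ gtr0_norm// mulrC ler_pM2r.
  - by rewrite linearB !linearZ /= fg scalerN addrC subrK.
have [F FP] := choice (fun nu : nat * V => step nu.1 nu.2).
pose fix u n := if n is k.+1 then (F (k, u k)).1 else v.
pose s n := \sum_(i < n) (F ((i : nat), u i)).2.
have ue n : `|u n| <= e * 2^-1 ^+ n.
  elim: n => [|n IH] /=; first by rewrite expr0 mulr1.
  by have [] := FP (n, u n) IH.
have fs n : f v = g (s n) + f (u n).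
  elim: n => [|n IH]; first by rewrite /s big_ord0 linear0 add0r.
  rewrite IH /s big_ord_recr /= linearD -addrA; congr (_ + _).
  by have [] := FP (n, u n) (ue n).
have [w wP] : exists w, forall n, `|w - s n| <= 2 * m * 2^-1 ^+ n.
  apply: cvg_telescope => [n|n|d d0].
  - by rewrite ltW// !mulr_gt0.
  - rewrite /s big_ord_recr /= addrAC subrr add0r.
    have [_ h _] := FP (n, u n) (ue n); rewrite (le_trans h)//.
    rewrite exprS mulrA [2 * m]mulrC mulrK; last by rewrite unitfE pnatr_eq0.
    by rewrite -mulrA mulr_natl mulr2n mulrDr addrK.
  - by apply: dyadic_small => //; rewrite mulr_gt0.
exists w; first by have := wP 0%N; rewrite /s big_ord0 subr0 expr0 mulr1.
apply/eqP; rewrite -subr_eq0; apply/eqP; apply: sepT => U.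
move=> /absconvex_nbhs0[C [nC cC CU]]; apply: CU.
have nC2 : nbhs (0 : T) (dilate 2^-1 C).
  by apply: nbhs0Z => //; rewrite invr_eq0 pnatr_eq0.
have [d d0 dP] := nbhs0_cball (continuous_linear0 cf nC2).
have [d' d'0 dP'] := nbhs0_cball (continuous_linear0 cg nC2).
have [n nd] := dyadic_small archK e0 d0.
have [n' nd'] := dyadic_small archK (mulr_gt0 (ltr0n K 2) m0) d'0.
have anti c k N : 0 < c -> (k <= N)%N -> c * 2^-1 ^+ N <= c * 2^-1 ^+ k :> K.
  move=> c0 kN; rewrite ler_pM2l// -(subnK kN) exprD.
  apply: ler_piMl; first exact: ltW.
  by rewrite exprn_ile1// ?invr_ge0// invf_le1// ler1n.
set N := maxn n n'.
have -> : f v - g w = f (u N) + g (s N - w).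
  by rewrite (fs N) linearB addrA [f _ + _]addrC.
apply: absconvex_half => //.
  apply: dP; rewrite (le_lt_trans (ue N))// (le_lt_trans _ nd)//.
  by apply: anti => //; exact: leq_maxl.
apply: dP'; rewrite distrC (le_lt_trans (wP N))// (le_lt_trans _ nd')//.
by apply: anti; [rewrite mulr_gt0|exact: leq_maxr].
Qed.

End Factorization.

(** * The norm of a Banach disk *)

Section BanachDisks.
Variables (K : numFieldType) (E : lmodType K).

Section Disk.
Variables (B : set E) (V : normedModType K) (f : {linear V -> E}).
Hypotheses (cB : absolutely_convex B) (B0 : B 0).
Hypothesis normE : forall v, `|v| = minkowski_functional B (f v).

(** The scalars need not be order complete, so the infimum may fail to exist.
    The functional then takes its default value 0, which the norm takes only at
    0, so that the conclusion still holds. *)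
Lemma disk_unit_ball v : `|v| < 1 -> B (f v).
Proof.
have zeroB : `|v| = 0 -> B (f v).
  by move=> /eqP; rewrite normr_eq0 => /eqP ->; rewrite linear0.
move=> v1; apply: contrapT => nBv; move: v1; rewrite normE.
have h1 : lbound [set l : K | 0 < l /\ dilate l B (f v)] 1.
  move=> l [l0 [b Bb bl]]; rewrite real_leNgt ?real1 ?gtr0_real//.
  apply/negP => l1; apply: nBv; rewrite -bl; apply: absconvexZ => //.
  by rewrite gtr0_norm// ltW.
move: zeroB; rewrite normE /minkowski_functional /infimum.
case: eqP => [_ /(_ erefl)//|_].
case: xgetP => [y _ [_ yP] _|_ /(_ erefl)//].
by move=> /(le_lt_trans (yP _ h1)); rewrite ltxx.
Qed.

Lemma disk_closed_ball v : B (f v) -> `|v| <= 1.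
Proof.
move=> Bv; rewrite normE /minkowski_functional /infimum.
case: eqP => [_|_]; first exact: ler01.
case: xgetP => [y _ [yP _]|_]; last exact: ler01.
by apply: yP; split => //; exists (f v); rewrite // scale1r.
Qed.

End Disk.

Lemma linear_span_sub (B : set E) : B `<=` linear_span B.
Proof.
move=> x Bx; exists 1%N, (fun=> 1), (fun=> x).
by rewrite big_ord1 scale1r.
Qed.

End BanachDisks.

(** * Regularity of complete LB-spaces *)

(** A vector x in every neighbourhood of 0 spans a bounded line.  In a Banach disk
    containing that line, x has Minkowski functional 0, so x = 0. *)
Lemma complete_separated (K : numFieldType) (T : tvsType K) :
  complete_bvs (tvs_born T) ->
  forall x : T, (forall U, nbhs (0 : T) U -> U x) -> x = 0.
Proof.
move=> cT x xU.
have lineU (c : K) U : nbhs (0 : T) U -> U (c *: x).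
  move=> nU; have [->|c0] := eqVneq c 0.
    by rewrite scale0r; exact: nbhs_singleton.
  have /xU[y Uy <-] := nbhs0Z (invr_neq0 c0) nU.
  by rewrite scalerA divff// scale1r.
have bline : tvs_bounded (range (fun c : K => c *: x)).
  move=> U nU; exists 1 => // _ [c _ <-]; exists (c *: x); rewrite ?scale1r//.
  exact: lineU.
have [B [_ [cB [V [f [If rf nf]]]] lineB]] := cT _ bline.
have Bx (c : K) : B (c *: x) by apply: lineB; exists c.
have : linear_span B x by apply: linear_span_sub; rewrite -[x]scale1r.
rewrite -rf => -[v _ vx].
suff : `|v| = 0 by move=> /eqP; rewrite normr_eq0 -vx => /eqP ->; rewrite linear0.
rewrite nf vx; apply: infimumP.
- by exists 1; split => //; exists (1 *: x); rewrite // !scale1r.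
- by move=> l [l0 _]; rewrite /= ltW.
- move=> y yP; apply: lt0_lbound => l l0; apply: yP; split => //.
  by exists (l^-1 *: x) => //; rewrite scalerA divff ?scale1r// gt_eqF.
Qed.

(** Grothendieck's factorization argument, applied to the inclusion into T of the
    Banach space of a disk B containing A. *)
Lemma LB_regular (K : numFieldType) (archK : archimedean_norm K)
    (S : banach_seq K) (T : tvsType K) (j : forall n, {linear S n -> T}) :
  complete_bvs (tvs_born T) -> is_colim_tc j ->
  forall A : set T, tvs_bounded A <-> union_bounded j A.
Proof.
move=> cT cj A; have [[_ ctj] _] := cj; have [_ _ sj] := tc_colim_union cj.
split; last first.
  move=> [n [r r0 Ar]]; apply: (bnd_subset (tvs_bounded_bornology T) Ar).
  exact (continuous_bounded_map (ctj n) (cball_bounded r0)).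
move=> bA; have [B0 bB0 B00] := bnd_cover (tvs_bounded_bornology T) 0.
(* Adding a set that contains 0 excludes an empty disk. *)
have [B [bB [cB [V [f [If rf nf]]]] AB]] :=
  cT _ (bnd_union (tvs_bounded_bornology T) bA bB0).
have B_0 : B 0 by apply: AB; right.
have cf : continuous f.
  apply: bounded_map_continuous.
  apply: (bnd_subset (tvs_bounded_bornology T) (B := dilate 2 B)); last first.
    exact: (bnd_scale (tvs_bounded_bornology T)).
  move=> _ [v v1 <-]; exists (f (2^-1 *: v)); last first.
    by rewrite -linearZ scalerA divff ?scale1r// pnatr_eq0.
  apply: (disk_unit_ball cB B_0 nf).
  rewrite normrZ gtr0_norm ?invr_gt0// mulrC ltr_pdivrMr// mul1r.
  by rewrite (le_lt_trans v1)// ltr1n.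
(* The pairs (n, m) of a level and a radius are enumerated by [unpickle]. *)
pose D k : set V := if unpickle k is Some (n, m) then
  [set v | exists2 w : S n, `|w| <= (m : nat).+1%:R & f v = j n w] else set0.
have [k [a [r [r0 kP]]]] : exists k (a : V) (r : K), 0 < r /\
    forall v, `|v - a| <= r -> forall e, 0 < e ->
      exists2 d, D k d & `|v - d| < e.
  apply: nonmeager => // v; have [n [w wE]] := sj (f v).
  have w1 : 0 < `|w| + 1 by rewrite ltr_wpDl.
  have [|m mw] := archK (`|w| + 1)^-1; first by rewrite invr_gt0.
  exists (pickle (n, m)); rewrite /D pickleK; exists w => //.
  move: mw; rewrite ltf_pV2 ?posrE// => /ltW; apply: le_trans.
  by rewrite lerDl.
move: kP; rewrite /D; case: unpickle => [[n m]|] kP; last first.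
  have [|d []] := kP a _ 1 ltr01.
  by rewrite subrr normr0 ltW.
have M0 : 0 < m.+1%:R :> K by [].
have lift : forall v, `|v| <= r ->
    exists2 w : S n, `|w| <= 2 * m.+1%:R & f v = j n w.
  apply: (approximate_lift archK cf (ctj n) (complete_separated cT) M0 r0).
  move=> v vr e e0.
  (* The ball where D is dense has centre a; since D is absolutely convex, half
     the difference of approximations of a + v and a - v approximates v. *)
  have [|d1 [w1 w1m fd1] vd1] := kP (a + v) _ e e0.
    by rewrite addrAC subrr add0r.
  have [|d2 [w2 w2m fd2] vd2] := kP (a - v) _ e e0.
    by rewrite addrAC subrr add0r normrN.
  exists (2^-1 *: (d1 - d2)), (2^-1 *: (w1 - w2)); split.
  - have -> : v - 2^-1 *: (d1 - d2) = 2^-1 *: ((a + v - d1) - (a - v - d2)).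
      have -> : a + v - d1 - (a - v - d2) = 2 *: v - (d1 - d2).
        rewrite -[a + v - d1]addrA -[a - v - d2]addrA opprD addrACA subrr add0r.
        by rewrite opprD !opprK addrACA scaler_nat mulr2n opprB [- d1 + _]addrC.
      by rewrite [RHS]scalerBr scalerK// pnatr_eq0.
    rewrite normrZ gtr0_norm ?invr_gt0// mulrC ltr_pdivrMr// mulr_natr mulr2n.
    by rewrite (le_lt_trans (ler_normB _ _))// ltrD.
  - rewrite normrZ gtr0_norm ?invr_gt0// mulrC ler_pdivrMr// mulr_natr mulr2n.
    by rewrite (le_trans (ler_normB _ _))// lerD.
  - by rewrite !linearZ !linearB /= fd1 fd2.
exists n, (2 * m.+1%:R / r); first by rewrite divr_gt0// mulr_gt0.
move=> x Ax; have Bx : B x by apply: AB; left.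
have : linear_span B x by exact: linear_span_sub.
rewrite -rf => -[v _ vx].
have v1 : `|v| <= 1 by apply: (disk_closed_ball nf); rewrite vx.
have [|w wm fw] := lift (r *: v).
  by rewrite normrZ gtr0_norm// ger_pMr.
exists (r^-1 *: w).
  by rewrite /cball /= normrZ gtr0_norm ?invr_gt0// mulrC ler_pM2r ?invr_gt0.
by rewrite linearZ /= -fw linearZ /= scalerA mulVf ?scale1r// gt_eqF.
Qed.

(** * The three classes *)

Lemma CBorn_LB_bLB (K : numFieldType) (archK : archimedean_norm K)
    (T : tvsType K) :
  CBorn (tvs_born T) -> LB_space T -> bLB (tvs_born T).
Proof.
move=> cT [S [j cj]]; exists T; last first.
  by exists idfun, idfun; split => // A bA; rewrite image_id.
exists S, j; split => //; apply: union_born_colim; first exact: tc_colim_union.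
exact: LB_regular.
Qed.

Lemma bLB_LBb (K : numFieldType) (E : bvsType K) : bLB E ->
  LBb E /\ exists T : tvsType K, E = tvs_born T.
Proof.
move=> [T [S [j [_ bj]]] ET]; split; last exact: isomorphic_tvs_born ET.
by exists S, (tvs_born T), j.
Qed.

Theorem theorem3p10 (R : realType) (k : numFieldType)
    (hk : k = R :> numFieldType \/ k = R[i] :> numFieldType) :
  (forall E : bvsType k,
     bLB E <-> CBorn E /\ exists2 T : tvsType k, LB_space T & E = tvs_born T) /\
  (forall E : bvsType k,
     (CBorn E /\ exists2 T : tvsType k, LB_space T & E = tvs_born T) <->
     (LBb E /\ exists T : tvsType k, E = tvs_born T)).
Proof.
have archk : archimedean_norm k.
  case: hk => ->; first exact: real_archimedean_norm.
  exact: complex_archimedean_norm.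
have AB (E : bvsType k) : bLB E -> LBb E /\ exists T : tvsType k, E = tvs_born T.
  exact: bLB_LBb.
have BC (E : bvsType k) : (LBb E /\ exists T : tvsType k, E = tvs_born T) ->
    CBorn E /\ exists2 T : tvsType k, LB_space T & E = tvs_born T.
  by move=> [lE [T ET]]; exact: LBb_CBorn_LB ET.
have CA (E : bvsType k) :
    (CBorn E /\ exists2 T : tvsType k, LB_space T & E = tvs_born T) -> bLB E.
  by move=> [cE [T lT ET]]; subst E; exact: CBorn_LB_bLB.
by split=> E; split=> h; [exact/BC/AB|exact: CA|exact/AB/CA|exact: BC].
Qed.
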